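(* Let $S$ be a regular $I$-bisimple semitopological semigroup. Then there exist a group $G$ with identity element $e$, an endomorphism $\theta\colon G\to G$, a collection $\{u_n\colon n\in\mathbb{Z}\}$ of elements of $G$ with $u_n=e$ for all $n\in\mathbb{N}$, and a topology on the semigroup $\mathscr{B}_W=\mathbb{Z}\times G\times\mathbb{Z}$ determined by $G$, $\theta$ and $\{u_n\}$, such that the following assertions hold: (i) $S$ is topologically isomorphic to the semitopological semigroup $\mathscr{B}_W$ (not necessarily with the product topology); (ii) $G_{i,j}$ and $G_{k,l}$ are homeomorphic subspaces of $\mathscr{B}_W$ for all $i,j,k,l\in\mathbb{Z}$; (iii) $G_{i,i}$ and $G_{k,k}$ are topologically isomorphic semitopological subgroups of $\mathscr{B}_W$ with the topology induced from $\mathscr{B}_W$, for all $i,k\in\mathbb{Z}$; (iv) $\theta$ is a continuous endomorphism of the semitopological group $G=G_{i,i}$ with the topology induced from $\mathscr{B}_W$, for an arbitrary integer $i$; (v) for every element $(i,g,j)\in\mathscr{B}_W$ there exists an open neighbourhood $U_{(i,g,j)}$ of $(i,g,j)$ in $\mathscr{B}_W$ such that $U_{(i,g,j)}\subseteq\bigcup\{G_{i-k,j-k}\colon k=0,1,2,3,\ldots\}$; (vi) $E(S)$ is a discrete subspace of $S$.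
   Context: All topological spaces are Hausdorff; $\mathbb{N}$ is the set of positive integers. A semitopological semigroup (group) is a Hausdorff topological space with a separately continuous semigroup (group) operation. $E(S)$ is the set of idempotents of $S$, ordered by $e\leqslant f$ iff $ef=fe=e$. A semigroup is bisimple if it has only one $\mathscr{D}$-class (Green's relation). A bisimple semigroup $S$ is $I$-bisimple if $E(S)$ is order isomorphic to $\mathbb{Z}$ under the reverse of the usual order. A semigroup $S$ is regular if $x\in xSx$ for every $x\in S$. Given a group $G$ with identity $e$, an endomorphism $\theta$ of $G$ (with $\theta^0=\mathrm{id}_G$) and elements $u_n\in G$ ($n\in\mathbb{Z}$) with $u_n=e$ for $n\in\mathbb{N}$, put $f_{0,n}=e$ and, for $m\in\mathbb{N}$, $n\in\mathbb{Z}$, $$f_{m,n}=\theta^{m-1}(u_{n+1})\cdot\theta^{m-2}(u_{n+2})\cdots\theta(u_{n+(m-1)})\cdot u_{n+m}.$$ Then $\mathscr{B}_W$ is the set $\mathbb{Z}\times G\times\mathbb{Z}$ with the semigroup operation $$(a,g,b)\cdot(c,h,d)=\begin{cases}(a,\ g\cdot f_{b-c,c}^{-1}\cdot\theta^{b-c}(h)\cdot f_{b-c,d},\ d-c+b), & b\geqslant c,\\ (a-b+c,\ f_{c-b,a}^{-1}\cdot\theta^{c-b}(g)\cdot f_{c-b,b}\cdot h,\ d), & b\leqslant c.\end{cases}$$ For $i,j\in\mathbb{Z}$, $G_{i,j}=\{(i,g,j)\in\mathscr{B}_W\colon g\in G\}$; $G$ is identified with $G_{i,i}$ via $g\leftrightarrow(i,g,i)$.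 (Warne: a regular semigroup is $I$-bisimple iff it is isomorphic to some such $\mathscr{B}_W$.) *)

(* Defs.v *)
From HB Require Import structures.
From mathcomp Require Import all_boot all_order all_algebra.
From mathcomp Require Import all_classical topology.

Set Implicit Arguments.
Unset Strict Implicit.
Unset Printing Implicit Defensive.

Import Order.TTheory GRing.Theory Num.Theory.
Local Open Scope classical_set_scope.
Local Open Scope ring_scope.

Section Semigroups.
Context {S : Type} (op : S -> S -> S).

Definition regular := forall x, exists y, x = op (op x y) x.

Definition idempotents : set S := [set e | op e e = e].

Definition idem_le (e f : S) := op e f = e /\ op f e = e.

(* The principal one-sided ideals S^1 a and a S^1, where S^1 is S with an
   identity adjoined if necessary. *)
Definition left_ideal (a : S) : set S :=
  [set x | x = a \/ exists s, x = op s a].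
Definition right_ideal (a : S) : set S :=
  [set x | x = a \/ exists s, x = op a s].

Definition green_L (a b : S) := left_ideal a = left_ideal b.
Definition green_R (a b : S) := right_ideal a = right_ideal b.
Definition green_D (a b : S) := exists c, green_L a c /\ green_R c b.

Definition bisimple := forall a b, green_D a b.

(* The index set of E(S) is Z with the reverse of its usual order. *)
Definition I_bisimple :=
  bisimple /\
  exists eps : int -> S, set_bij [set: int] idempotents eps /\
    forall m n : int, idem_le (eps m) (eps n) <-> n <= m.

Definition is_group :=
  associative op /\
  exists e, [/\ left_id e op, right_id e op &
    forall x, exists y, op x y = e /\ op y x = e].

End Semigroups.

Definition separately_continuous (T : topologicalType) (op : T -> T -> T) :=
  forall x, continuous (op x) /\ continuous (op^~ x).

Definition semitopological_semigroup (T : topologicalType) (op : T -> T -> T) :=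
  [/\ hausdorff_space T, associative op & separately_continuous op].

Definition semitopological_group (T : topologicalType) (op : T -> T -> T) :=
  [/\ hausdorff_space T, is_group op & separately_continuous op].

Definition homeomorphism (X Y : topologicalType) (f : X -> Y) :=
  continuous f /\ exists g : Y -> X, [/\ continuous g, cancel f g & cancel g f].

Definition homeomorphic (X Y : topologicalType) :=
  exists f : X -> Y, homeomorphism f.

Definition topologically_isomorphic (X Y : topologicalType)
    (opX : X -> X -> X) (opY : Y -> Y -> Y) :=
  exists f : X -> Y, homeomorphism f /\ {morph f : x y / opX x y >-> opY x y}.

Definition discrete_subspace (T : topologicalType) (A : set T) :=
  forall U : set (set_type A), open U.

(* A topology as a first-class object, so that it can be quantified over; the
   alias [with_topology t] of the carrier is the corresponding space. *)
Record topology_on (X : Type) := TopologyOn {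
  topology_open : set_system X;
  topology_openT : topology_open setT;
  topology_openI : setI_closed topology_open;
  topology_open_bigU : forall (I : Type) (f : I -> set X),
    (forall i, topology_open (f i)) -> topology_open (\bigcup_i f i)
}.

Definition with_topology (X : Type) (t : topology_on X) : Type := X.

HB.instance Definition _ (X : choiceType) (t : topology_on X) :=
  Choice.copy (with_topology t) X.
HB.instance Definition _ (X : choiceType) (t : topology_on X) :=
  isOpenTopological.Build (with_topology t)
    (topology_openT t) (topology_openI (t := t)) (topology_open_bigU (t := t)).

Definition BW (G : groupType) : Type := (int * G * int)%type.
HB.instance Definition _ (G : groupType) :=
  Choice.copy (BW G) (int * G * int)%type.

Section BWOperation.
Context {G : groupType} (theta : {multiplicative G -> G}) (u : int -> G).

Definition BW_f (m : nat) (n : int) : G :=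
  (\prod_(k < m) iter (m - k.+1) theta (u (n + k.+1%:Z)))%g.

(* [`|b - c|%N] is the natural number b - c, resp. c - b. *)
Definition BW_mul (x y : BW G) : BW G :=
  let: (a, g, b) := x in
  let: (c, h, d) := y in
  let m := `|b - c|%N in
  if c <= b then
    (a, (g * (BW_f m c)^-1 * iter m theta h * BW_f m d)%g, d - c + b)
  else
    (a - b + c, ((BW_f m a)^-1 * iter m theta g * BW_f m b * h)%g, d).

End BWOperation.

Section Components.
Context {G : groupType} (t : topology_on (BW G)).

Definition BW_component (i j : int) : set (with_topology t) :=
  [set x | exists g : G, x = (i, g, j)].

Definition BW_embed (i : int) (g : G) : with_topology t := (i, g, i).

(* G with the topology induced by its identification with G_{i,i}. *)
Definition BW_group_at (i : int) : Type := initial_topology (BW_embed i).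
HB.instance Definition _ (i : int) :=
  Topological.copy (BW_group_at i) (initial_topology (BW_embed i)).

Context (theta : {multiplicative G -> G}) (u : int -> G).

Lemma BW_diagonal_closed (i : int) (x y : with_topology t) :
  BW_component i i x -> BW_component i i y ->
  BW_component i i (BW_mul theta u x y).
Proof.
move=> [g ->] [h ->]; rewrite /BW_mul lexx !subrr add0r.
by eexists.
Qed.

(* The operation of B_W restricted to G_{i,i}. *)
Definition BW_diagonal_mul (i : int) (x y : set_type (BW_component i i)) :
    set_type (BW_component i i) :=
  SigSub (mem_set (BW_diagonal_closed (set_mem (valP x)) (set_mem (valP y)))).

End Components.

Arguments BW_component {G} t i j.
Arguments BW_embed {G} t i g.
Arguments BW_group_at {G} t i.
Arguments BW_diagonal_mul {G} t theta u i x y.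

(* Main.v *)
Require Import Defs.
From HB Require Import structures.
From mathcomp Require Import all_boot all_order all_algebra.
From mathcomp Require Import all_classical topology.
From mathcomp Require Import zify.

Set Implicit Arguments.
Unset Strict Implicit.
Unset Printing Implicit Defensive.

Import Order.TTheory GRing.Theory Num.Theory.
Local Open Scope classical_set_scope.
Local Open Scope ring_scope.

(** Algebra.  The idempotents of S form a chain (eps n), with eps m * eps n =
eps (max m n); in particular they commute, so that the regular semigroup S is
an inverse semigroup.  Think of an element p with inverse q as an arrow from
eps i to eps j, where p q = eps i and q p = eps j.  Regularity makes every
element an arrow, and bisimplicity provides an arrow between any two
idempotents.  Conjugation by an arrow from eps i to eps j is an isomorphism
between the chains below eps i and below eps j; these are copies of the natural
numbers, which have no order automorphism but the identity, so conjugation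
merely translates indices ([arrow_conj]).  This rigidity determines the ends of
every product of arrows ([arrow_comp]).

Let G be the maximal subgroup at eps 0, and choose arrows y_n from eps 0 to
eps n such that y_0 = eps 0 and y_{n+1} = y_1 y_n for n >= 0.  Every element of
S is y_i^-1 g y_j for exactly one triple (i, g, j).  Commuting y_1 past an
element of G defines theta, by y_1 g = theta(g) y_1, and commuting it past the
other representatives defines u, by y_1 y_n = u_{n+1} y_{n+1}; iteration yields
y_m y_n = f_{m,n} y_{n+m} for m >= 0.  Bringing a product
y_i^-1 g y_j y_k^-1 h y_l into normal form is then the multiplication rule of
B_W: directly if k <= j ([of_coordsM_le]), and by passing to inverses if
j < k ([of_coordsM]).

Topology.  B_W receives the topology of S through this bijection.  The
components G_{i,j} are exchanged by two-sided translations, which are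
continuous, and theta is a composite of such translations; this settles (i) to
(iv).  For (v), a product e x being different from x is an open condition in a
Hausdorff space.  Hence the set Q of the elements (a, h, b) with a <= i and
b <= j is open: these are the x for which (i+1, 1, i+1) x <> x and
x (j+1, 1, j+1) <> x.  Multiplying (a, h, b) in Q by the idempotents
(i, 1, i) and (j, 1, j) gives the end points (i, b-a+i) if b-a+i >= j, and
(a-b+j, j) otherwise, so the product is again in Q only if a-b = i-j.  Thus the
open set of those x in Q whose product is in Q is contained in the diagonal
below (i, j) ([component_nbhs]).  For (vi), eps n is the only idempotent x with
eps (n+1) x <> x and eps (n-1) x <> eps (n-1), and both conditions are open. *)

(** * Uniqueness of inverses *)
Section InverseSemigroups.
Context {S : Type} (op : S -> S -> S) (opA : associative op).
Local Notation "x ** y" := (op x y) (at level 40, left associativity).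

(** Products are kept associated to the left; these two lemmas rewrite with an
equation between products that ends inside a longer product. *)
Lemma opE2 a b c : a ** b = c -> forall s, s ** a ** b = s ** c.
Proof. by move=> abc s; rewrite -opA abc. Qed.

Lemma opE3 a b c d : a ** b ** c = d -> forall s, s ** a ** b ** c = s ** d.
Proof. by move=> abcd s; rewrite -abcd !opA. Qed.

Definition mutually_inverse (x y : S) := x ** y ** x = x /\ y ** x ** y = y.

Lemma mutually_inverse_sym x y : mutually_inverse x y -> mutually_inverse y x.
Proof. by case. Qed.

Lemma mutually_inverse_idem x y :
  mutually_inverse x y -> (x ** y) ** (x ** y) = x ** y.
Proof. by case=> xyx _; rewrite opA xyx. Qed.

(** Both inverses equal z x y: in y = (y x) (z x) y the two idempotents commute,
and so do (x y) and (x z) in z = z (x y) (x z). *)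
Lemma mutually_inverse_uniq :
  (forall e f, e ** e = e -> f ** f = f -> e ** f = f ** e) ->
  forall x y z, mutually_inverse x y -> mutually_inverse x z -> y = z.
Proof.
move=> idemC x y z xy xz; have [xyx yxy] := xy; have [xzx zxz] := xz.
have yz_left : (y ** x) ** (z ** x) = (z ** x) ** (y ** x).
  by apply: idemC; apply/mutually_inverse_idem/mutually_inverse_sym.
have yz_right : (x ** y) ** (x ** z) = (x ** z) ** (x ** y).
  by apply: idemC; apply/mutually_inverse_idem.
have -> : y = z ** x ** y.
  transitivity ((y ** x) ** (z ** x) ** y); last first.
    by rewrite yz_left !opA (opE3 yxy).
  by rewrite !opA (opE3 xzx) yxy.
transitivity (z ** ((x ** y) ** (x ** z))); first last.
  by rewrite !opA (opE3 xyx).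
by rewrite yz_right !opA zxz.
Qed.

End InverseSemigroups.

(** * The maximal subgroup at an idempotent *)
Section MaximalSubgroup.
Context {S : choiceType} (op : S -> S -> S) (opA : associative op).
Context (e : S) (ee : op e e = e).
Local Notation "x ** y" := (op x y) (at level 40, left associativity).

Definition inverse_at (g h : S) :=
  [/\ g ** h = e, h ** g = e, e ** g = g & e ** h = h].

Lemma inverse_at_sym g h : inverse_at g h -> inverse_at h g.
Proof. by case. Qed.

Lemma inverse_at_idr g h : inverse_at g h -> g ** e = g.
Proof. by case=> gh hg eg eh; rewrite -hg opA gh. Qed.

Lemma inverse_at_id : inverse_at e e. Proof. by []. Qed.

Lemma inverse_atM g h g' h' :
  inverse_at g h -> inverse_at g' h' -> inverse_at (g ** g') (h' ** h).
Proof.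
move=> gh gh'; have ge := inverse_at_idr gh.
have he' := inverse_at_idr (inverse_at_sym gh').
case: gh gh' => gh hg eg eh [gh' hg' eg' eh'].
by split; rewrite !opA ?eg ?eh' // ?(opE2 opA gh') ?(opE2 opA hg) ?ge ?he'.
Qed.

(** The proofs of associativity and idempotency are parameters of the type so
that the group structure, which depends on them, can be inferred from it. *)
Definition maximal_subgroup (_ : associative op) (_ : op e e = e) : Type :=
  {g : S | `[< exists h, inverse_at g h >]}.
Local Notation H := (maximal_subgroup opA ee).

HB.instance Definition _ :=
  Choice.copy H {g : S | `[< exists h, inverse_at g h >]}.

Definition subgroup_elt (g : S) (gP : exists h, inverse_at g h) : H :=
  exist _ g (asboolT gP).

Lemma subgroup_eltP (g : H) : {h | inverse_at (sval g) h}.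
Proof. by apply: cid; exact/asboolP/(svalP g). Qed.

Lemma subgroup_elt_inj (g h : H) : sval g = sval h -> g = h.
Proof.
by move=> gh; apply: eq_sig_hprop gh => ? ? ?; exact: Prop_irrelevance.
Qed.

Definition subgroup_one : H := subgroup_elt (ex_intro _ e inverse_at_id).

Definition subgroup_inv (g : H) : H :=
  let: exist h gh := subgroup_eltP g in
  subgroup_elt (ex_intro _ (sval g) (inverse_at_sym gh)).

Definition subgroup_mul (g g' : H) : H :=
  let: exist h gh := subgroup_eltP g in
  let: exist h' gh' := subgroup_eltP g' in
  subgroup_elt (ex_intro _ (h' ** h) (inverse_atM gh gh')).

Lemma subgroup_mulE g g' : sval (subgroup_mul g g') = sval g ** sval g'.
Proof. by rewrite /subgroup_mul; do 2 case: subgroup_eltP. Qed.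

Lemma subgroup_invP g : inverse_at (sval g) (sval (subgroup_inv g)).
Proof. by rewrite /subgroup_inv; case: subgroup_eltP. Qed.

Lemma subgroup_mulA : associative subgroup_mul.
Proof.
by move=> x y z; apply: subgroup_elt_inj; rewrite !subgroup_mulE opA.
Qed.

Lemma subgroup_mul1 : left_id subgroup_one subgroup_mul.
Proof.
move=> x; apply: subgroup_elt_inj; rewrite !subgroup_mulE /=.
by case: (subgroup_invP x).
Qed.

Lemma subgroup_mulr1 : right_id subgroup_one subgroup_mul.
Proof.
move=> x; apply: subgroup_elt_inj; rewrite !subgroup_mulE /=.
exact: inverse_at_idr (subgroup_invP x).
Qed.

Lemma subgroup_mulV : left_inverse subgroup_one subgroup_inv subgroup_mul.
Proof.
move=> x; apply: subgroup_elt_inj; rewrite !subgroup_mulE /=.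
by case: (subgroup_invP x).
Qed.

Lemma subgroup_mulrV : right_inverse subgroup_one subgroup_inv subgroup_mul.
Proof.
move=> x; apply: subgroup_elt_inj; rewrite !subgroup_mulE /=.
by case: (subgroup_invP x).
Qed.

HB.instance Definition _ := isGroup.Build H subgroup_mulA subgroup_mul1
  subgroup_mulr1 subgroup_mulV subgroup_mulrV.

Lemma val_subgroupM (g h : H) : sval (g * h)%g = sval g ** sval h.
Proof. exact: subgroup_mulE. Qed.

Lemma val_subgroup1 : sval (1%g : H) = e. Proof. by []. Qed.

Lemma val_subgroupV (g : H) : inverse_at (sval g) (sval g^-1%g).
Proof. exact: subgroup_invP. Qed.

End MaximalSubgroup.

(** * Computing in B_W *)
Section GroupEndomorphisms.
Context {G : groupType} (theta : {multiplicative G -> G}) (u : int -> G).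

Lemma endo1 : theta 1%g = 1%g.
Proof. by apply: (mulgI (theta 1%g)); rewrite -gmulfM !mulg1. Qed.

Lemma endoV g : theta g^-1%g = (theta g)^-1%g.
Proof. by apply: (mulgI (theta g)); rewrite -gmulfM !mulgV endo1. Qed.

Lemma iter_endo1 m : iter m theta 1%g = 1%g.
Proof. by elim: m => //= m ->; exact: endo1. Qed.

Lemma iter_endoV m g : iter m theta g^-1%g = (iter m theta g)^-1%g.
Proof. by elim: m => //= m ->; exact: endoV. Qed.

Lemma BW_f0 n : BW_f theta u 0 n = 1%g.
Proof. by rewrite /BW_f big_ord0. Qed.

(** Splitting off the last factor expresses f_{m+1,n} by f_{m,n}; this is the
recursion satisfied by the coefficient of y_{n+m} in y_m y_n. *)
Lemma BW_fS m n :
  BW_f theta u m.+1 n = (theta (BW_f theta u m n) * u (n + m.+1%:Z))%g.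
Proof.
rewrite /BW_f big_ord_recr /= subnn (big_morph _ (@gmulfM _ _ theta) endo1).
by congr (_ * _)%g; apply: eq_bigr => k _; rewrite subSn //=.
Qed.

Lemma BW_f1 (m : nat) (n : int) : (forall k : int, 0 < k -> u k = 1%g) ->
  0 <= n -> BW_f theta u m n = 1%g.
Proof.
move=> u1 n0; elim: m => [|m IHm]; first by rewrite BW_f0.
by rewrite BW_fS IHm endo1 u1 ?mulg1 //; lia.
Qed.

Lemma BW_mul_eq a g b h d :
  BW_mul theta u (a, g, b) (b, h, d) = (a, (g * h)%g, d).
Proof.
by rewrite /= lexx subrr /= !BW_f0 invg1 !mulg1 subrK.
Qed.

(** The right ideal generated by (n, 1, n) consists of the triples whose first
coordinate is at least n; it is the fixed set of a left translation, which is
how the topology sees the coordinates. *)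
Lemma BW_mull_eq n a (g : G) b :
  BW_mul theta u (n, 1%g, n) (a, g, b) = (a, g, b) <-> n <= a.
Proof.
split; last first.
  rewrite le_eqVlt => /orP[/eqP <-|na]; first by rewrite BW_mul_eq mul1g.
  rewrite /= leNgt na /= iter_endo1 mulg1 mulVg mul1g.
  by congr (_, _, _); lia.
by rewrite /=; case: ifP => [_ []|]; lia.
Qed.

Lemma BW_mulr_eq n a (g : G) b :
  BW_mul theta u (a, g, b) (n, 1%g, n) = (a, g, b) <-> n <= b.
Proof.
split; last first.
  move=> nb; rewrite /= nb iter_endo1 mulg1 mulgVK.
  by congr (_, _, _); lia.
by rewrite /=; case: ifP => // nb /(congr1 snd) /= nbE; lia.
Qed.

End GroupEndomorphisms.

(** * Arrows between the idempotents of a chain *)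
Section ChainOfIdempotents.
Context {S : choiceType} (op : S -> S -> S) (opA : associative op).
Local Notation "x ** y" := (op x y) (at level 40, left associativity).
Context (eps : int -> S) (eps_inj : injective eps)
  (epsM : forall m n, eps m ** eps n = eps (Order.max m n))
  (epsP : forall e, e ** e = e -> exists n, e = eps n).

Lemma eps_idem n : eps n ** eps n = eps n.
Proof. by rewrite epsM maxxx. Qed.

Lemma eps_comm e f : e ** e = e -> f ** f = f -> e ** f = f ** e.
Proof. by move=> /epsP[m ->] /epsP[n ->]; rewrite !epsM maxC. Qed.

(** In terms of Green's relations: q is the inverse of p, and p lies in the
R-class of eps i and in the L-class of eps j. *)
Definition arrow i j p q :=
  [/\ p ** q = eps i, q ** p = eps j, eps i ** p = p & eps j ** q = q].

Lemma arrow_sym i j p q : arrow i j p q -> arrow j i q p.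
Proof. by case. Qed.

Lemma arrow_idr i j p q : arrow i j p q -> p ** eps j = p.
Proof. by case=> pq qp ep eq; rewrite -qp opA pq. Qed.

Lemma arrow_mutually_inverse i j p q :
  arrow i j p q -> mutually_inverse op p q.
Proof. by case=> pq qp ep eq; split; rewrite ?pq ?qp. Qed.

Lemma arrow_eps i : arrow i i (eps i) (eps i).
Proof. by split; rewrite eps_idem. Qed.

Lemma arrow_conjM i j p q k l : arrow i j p q -> i <= k ->
  (q ** eps k ** p) ** (q ** eps l ** p) = q ** eps (Order.max k l) ** p.
Proof.
move=> [pq qp ep eq] ik.
by rewrite !opA (opE2 opA pq) (opE2 opA (epsM k i)) max_l //
  (opE2 opA (epsM _ _)).
Qed.

Lemma arrow_conjK i j p q k : arrow i j p q -> i <= k ->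
  p ** (q ** eps k ** p) ** q = eps k.
Proof.
move=> [pq qp ep eq] ik.
by rewrite !opA (opE2 opA pq) pq !epsM (max_r ik) max_l.
Qed.

(** Conjugation by an arrow is injective on the idempotents below eps i, so the
idempotent after eps (i + n) goes strictly below eps (j + n). *)
Lemma arrow_conj_lt i j p q (n : nat) : arrow i j p q ->
  q ** eps (i + n%:Z) ** p = eps (j + n%:Z) ->
  exists2 k, j + n.+1%:Z <= k & q ** eps (i + n.+1%:Z) ** p = eps k.
Proof.
move=> pq conj_n.
have [k conjS] : exists k, q ** eps (i + n.+1%:Z) ** p = eps k.
  by apply: epsP; rewrite (arrow_conjM _ pq) ?maxxx //; lia.
exists k => //.
have : eps k ** eps (j + n%:Z) = eps k.
  by rewrite -conjS -conj_n (arrow_conjM _ pq) ?max_l //; lia.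
rewrite epsM => /eps_inj maxk.
have k_ne : k <> j + n%:Z.
  move=> k_eq; have := arrow_conjK pq (k := i + n.+1%:Z).
  rewrite conjS k_eq -conj_n (arrow_conjK pq); last by lia.
  by move=> /(_ ltac:(lia)) /eps_inj; lia.
by move: maxk; rewrite maxEle; case: ifP; lia.
Qed.

(** An order isomorphism between two copies of the natural numbers is unique.
The induction treats an arrow and its inverse together: each moves the next
index at least as far as the translation would, and as they cancel each other,
neither can move it further. *)
Lemma arrow_conj_nat n : forall i j p q, arrow i j p q ->
  q ** eps (i + n%:Z) ** p = eps (j + n%:Z).
Proof.
elim: n => [|n IHn] i j p q pq.
  by case: (pq) => _ qp ep _; rewrite !addr0 -opA ep.
have qp := arrow_sym pq.
have [k jk conjk] := arrow_conj_lt pq (IHn _ _ _ _ pq).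
have [l il conjl] := arrow_conj_lt qp (IHn _ _ _ _ qp).
have : eps (j + n.+1%:Z) ** eps k = eps (j + n.+1%:Z).
  rewrite -(arrow_conjK qp (k := j + n.+1%:Z)); last by lia.
  by rewrite conjl -conjk (arrow_conjM _ pq) ?max_l //; lia.
rewrite conjk epsM => /eps_inj maxk; congr (eps _).
by move: maxk; rewrite maxEle; case: ifP; lia.
Qed.

Lemma arrow_conj i j p q k : arrow i j p q -> i <= k ->
  q ** eps k ** p = eps (j + (k - i)).
Proof.
move=> pq ik; have := arrow_conj_nat `|k - i|%N pq.
by rewrite gez0_abs ?subr_ge0 // [i + _]addrC subrK.
Qed.

(** The product restricts p' to eps j, which lies below its source eps k, and
conjugation by p' takes eps j to the idempotent in the conclusion.  The case
j <= k follows by passing to inverses. *)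
Lemma arrow_comp i j p q k l p' q' : arrow i j p q -> arrow k l p' q' ->
  k <= j -> arrow i (l + (j - k)) (p ** p') (q' ** q).
Proof.
move=> pq pq' kj; have conj_j := arrow_conj pq' kj.
have pj := arrow_idr pq; have := pq; have := pq'.
case=> pq_' qp_' ep' eq' [pq_ qp_ ep eq].
split.
- by rewrite !opA (opE2 opA pq_') -{1}pj (opE2 opA (epsM _ _)) max_l // pj.
- by rewrite !opA (opE2 opA qp_).
- by rewrite !opA ep.
- rewrite -conj_j !opA (opE2 opA pq_') (opE2 opA (epsM _ _)) max_l //.
  by rewrite (opE2 opA eq).
Qed.

Lemma arrow_comp_eq i j p q l p' q' : arrow i j p q -> arrow j l p' q' ->
  arrow i l (p ** p') (q' ** q).
Proof.
by move=> pq pq'; have := arrow_comp pq pq' (lexx j); rewrite subrr addr0.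
Qed.

(** * Coordinates *)

Context (y y' : int -> S) (yP : forall n, arrow 0 n (y n) (y' n))
  (y0 : y 0 = eps 0) (yS : forall n, 0 <= n -> y (n + 1) = y 1 ** y n).

Local Notation G := (maximal_subgroup opA (eps_idem 0)).

Lemma arrow_elt (g : G) : arrow 0 0 (sval g) (sval g^-1%g).
Proof. exact: val_subgroupV. Qed.

Lemma arrow_shift m n :
  0 <= m -> arrow 0 (n + m) (y m ** y n) (y' n ** y' m).
Proof. by move=> m0; have := arrow_comp (yP m) (yP n) m0; rewrite subr0. Qed.

Lemma theta_subproof (g : G) :
  arrow 0 0 (y 1 ** sval g ** y' 1) (y 1 ** sval g^-1%g ** y' 1).
Proof.
have := arrow_comp_eq (arrow_comp (yP 1) (arrow_elt g) ler01)
  (arrow_sym (yP 1)).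
by rewrite !opA.
Qed.

Definition theta_fun (g : G) : G :=
  subgroup_elt opA (eps_idem 0) (ex_intro _ _ (theta_subproof g)).

(** y_1 g ends at eps 1, so the factor y_1^-1 y_1 = eps 1 on its right can be
absorbed. *)
Lemma theta_funE g : y 1 ** sval g = sval (theta_fun g) ** y 1.
Proof.
rewrite /= (opE2 opA (let: And4 _ e _ _ := yP 1 in e)).
by rewrite (arrow_idr (arrow_comp (yP 1) (arrow_elt g) ler01)).
Qed.

Lemma theta_funM : {morph theta_fun : g h / (g * h)%g}.
Proof.
move=> g h; apply: subgroup_elt_inj; rewrite [RHS]val_subgroupM /=.
rewrite val_subgroupM !opA; congr (_ ** _ ** _).
by rewrite -[y 1 ** _ ** y' 1]/(sval (theta_fun g)) -theta_funE.
Qed.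

HB.instance Definition _ := isMultiplicative.Build G G theta_fun theta_funM.

Lemma u_subproof n :
  arrow 0 0 (y 1 ** y (n - 1) ** y' n) (y n ** (y' (n - 1) ** y' 1)).
Proof.
have := arrow_shift (n - 1) ler01; rewrite subrK => yy.
exact: arrow_comp_eq yy (arrow_sym (yP n)).
Qed.

Definition u_elt (n : int) : G :=
  subgroup_elt opA (eps_idem 0) (ex_intro _ _ (u_subproof n)).

Lemma u_eltE n : y 1 ** y n = sval (u_elt (n + 1)) ** y (n + 1).
Proof.
rewrite /= addrK (opE2 opA (let: And4 _ e _ _ := yP (n + 1) in e)).
by rewrite (arrow_idr (arrow_shift n ler01)).
Qed.

Lemma u_elt_pos n : 0 < n -> u_elt n = 1%g.
Proof.
move=> n0; apply: subgroup_elt_inj; rewrite val_subgroup1 /=.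
by rewrite -yS ?subrK; [case: (yP n)|lia].
Qed.

Lemma y_mul_elt (m : nat) (g : G) :
  y m%:Z ** sval g = sval (iter m theta_fun g) ** y m%:Z.
Proof.
elim: m => [|m IHm] /=.
  have [_ _ eg _] := arrow_elt g.
  by rewrite y0 eg (arrow_idr (arrow_elt g)).
rewrite -addn1 PoszD yS // -opA IHm !opA; congr (_ ** _).
exact: theta_funE.
Qed.

Lemma y_mul_y (m : nat) (n : int) :
  y m%:Z ** y n = sval (BW_f theta_fun u_elt m n) ** y (n + m%:Z).
Proof.
elim: m => [|m IHm]; first by rewrite BW_f0 val_subgroup1 y0 addr0.
rewrite BW_fS val_subgroupM -[m.+1]addn1 PoszD yS // -opA IHm opA theta_funE.
by rewrite -opA u_eltE opA addrA.
Qed.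

Definition of_coords (w : BW G) : S :=
  let: (i, g, j) := w in y' i ** sval g ** y j.

Definition coords_inv (w : BW G) : BW G :=
  let: (i, g, j) := w in (j, g^-1%g, i).

Lemma of_coords_arrow i (g : G) j :
  arrow i j (of_coords (i, g, j)) (of_coords (coords_inv (i, g, j))).
Proof.
have := arrow_comp_eq (arrow_comp_eq (arrow_sym (yP i)) (arrow_elt g)) (yP j).
by rewrite /= !opA.
Qed.

(** The equation y_m y_k = f_{m,k} y_j with m = j - k, solved for y_j y_k^-1. *)
Lemma y_mul_inv (j k : int) : k <= j ->
  y j ** y' k = sval (BW_f theta_fun u_elt `|j - k| k)^-1%g ** y `|j - k|%:Z.
Proof.
move=> kj; set m := `|j - k|%N; set f := BW_f _ _ _ _.
have [ff vf ef _] := arrow_elt f.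
have [yk _ _ _] := yP k; have [_ _ ej _] := yP j.
have : y m%:Z ** y k ** y' k = sval f ** y j ** y' k.
  by rewrite y_mul_y -/f /m gez0_abs ?subr_ge0 // [k + _]addrC subrK.
have -> : y m%:Z ** y k ** y' k = y m%:Z.
  have := y_mul_elt m 1%g; rewrite (opE2 opA yk) iter_endo1 val_subgroup1 => ->.
  by case: (yP m%:Z).
move=> ->.
by rewrite !opA vf ej.
Qed.

Lemma of_coordsM_le i (g : G) j k (h : G) l : k <= j ->
  of_coords (BW_mul theta_fun u_elt (i, g, j) (k, h, l)) =
  of_coords (i, g, j) ** of_coords (k, h, l).
Proof.
move=> kj; rewrite /= kj /= !opA.
rewrite (opE2 opA (y_mul_inv kj)) !opA.
rewrite (opE2 opA (y_mul_elt _ h)) !opA.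
rewrite (opE2 opA (y_mul_y _ l)) !opA.
rewrite !val_subgroupM !opA gez0_abs ?subr_ge0 //.
by congr (_ ** y _); lia.
Qed.

(** Inversion is an anti-automorphism of B_W; it exchanges the two clauses of
the multiplication. *)
Lemma coords_invM_lt i (g : G) j k (h : G) l : j < k ->
  coords_inv (BW_mul theta_fun u_elt (i, g, j) (k, h, l)) =
  BW_mul theta_fun u_elt (coords_inv (k, h, l)) (coords_inv (i, g, j)).
Proof.
move=> jk; rewrite /= lt_geF // (ltW jk) /= !invgM invgK !mulgA.
have -> : `|j - k|%N = `|k - j|%N by lia.
by rewrite iter_endoV; congr (_, _, _); lia.
Qed.

(** If j < k, then [of_coordsM_le] applies to the product of the inverses in the
opposite order.  Both sides of the claim are inverse to that product, hence
equal. *)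
Lemma of_coordsM :
  {morph of_coords : v w / BW_mul theta_fun u_elt v w >-> v ** w}.
Proof.
case=> [[i g] j] [[k h] l].
case: (lerP k j) => [kj|jk]; first exact: of_coordsM_le.
apply: (@mutually_inverse_uniq _ op opA eps_comm
  (of_coords (coords_inv (k, h, l)) ** of_coords (coords_inv (i, g, j)))).
- rewrite -of_coordsM_le; last exact: ltW.
  rewrite -[X in mutually_inverse _ (of_coords X) _](coords_invM_lt i g h l jk).
  case: BW_mul => [[a f] b].
  exact/mutually_inverse_sym/arrow_mutually_inverse/of_coords_arrow.
- exact: arrow_mutually_inverse (arrow_comp (arrow_sym (of_coords_arrow k h l))
    (arrow_sym (of_coords_arrow i g j)) (ltW jk)).
Qed.

(** The idempotents s s^-1 and s^-1 s recover i and j, and y_i s y_j^-1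
recovers g. *)
Lemma of_coords_inj : injective of_coords.
Proof.
case=> [[i g] j] [[k h] l] eq_s.
have ig := of_coords_arrow i g j; have kh := of_coords_arrow k h l.
have eq_t : of_coords (coords_inv (i, g, j)) = of_coords (coords_inv (k, h, l)).
  apply: (mutually_inverse_uniq opA eps_comm (arrow_mutually_inverse ig)).
  by rewrite eq_s; exact: arrow_mutually_inverse kh.
have [ik _ _ _] := ig; have [] := kh; rewrite -eq_s -eq_t {}ik => /eps_inj ik.
have [_ jl _ _] := ig; rewrite {}jl => /eps_inj jl _ _; subst k l.
congr (_, _, _); apply: subgroup_elt_inj.
have cut (f : G) : y i ** of_coords (i, f, j) ** y' j = sval f.
  have [_ _ ef _] := arrow_elt f; have fe := arrow_idr (arrow_elt f).
  have [yi _ _ _] := yP i; have [yj _ _ _] := yP j.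
  by rewrite /= !opA yi ef (opE2 opA yj) fe.
by rewrite -cut eq_s cut.
Qed.

Lemma of_coords_surj i j s t : arrow i j s t -> exists w, of_coords w = s.
Proof.
move=> st.
have ij := arrow_comp_eq (arrow_comp_eq (yP i) st) (arrow_sym (yP j)).
exists (i, subgroup_elt opA (eps_idem 0) (ex_intro _ _ ij), j).
have [_ yi _ _] := yP i; have [_ yj _ _] := yP j; have [_ _ es _] := st.
by rewrite /= !opA yi es (opE2 opA yj) (arrow_idr st).
Qed.

End ChainOfIdempotents.

(** * Coordinates on a regular I-bisimple semigroup *)
Section Warne.
Context {S : choiceType} (op : S -> S -> S) (opA : associative op).
Local Notation "x ** y" := (op x y) (at level 40, left associativity).

Lemma green_L_idem e c : e ** e = e -> green_L op e c ->
  c ** e = c /\ exists s, s ** c = e.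
Proof.
move=> ee ec; split.
  have [->//|[s ->]] : left_ideal op e c by rewrite ec; left.
  by rewrite -opA ee.
have [<-|[s es]] : left_ideal op c e by rewrite -ec; left.
  by exists e.
by exists s.
Qed.

Lemma green_R_idem e c : e ** e = e -> green_R op c e ->
  e ** c = c /\ exists t, c ** t = e.
Proof.
move=> ee ce; split.
  have [->//|[s ->]] : right_ideal op e c by rewrite -ce; left.
  by rewrite opA ee.
have [<-|[s es]] : right_ideal op c e by rewrite ce; left.
  by exists e.
by exists s.
Qed.

(** An element c that is L-related to eps j and R-related to eps i is an arrow;
if c t = eps i, then eps j t is its inverse. *)
Lemma arrow_of_bisimple (eps : int -> S) i j :
  (forall n, eps n ** eps n = eps n) ->
  bisimple op -> exists p q, arrow op eps i j p q.
Proof.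
move=> eps_idem /(_ (eps j) (eps i))[c [/green_L_idem Lc /green_R_idem Rc]].
have [cj [s sc]] := Lc (eps_idem j); have [ic [t ct]] := Rc (eps_idem i).
exists c, (eps j ** t); split; rewrite ?opA ?eps_idem ?cj //.
by rewrite -{1}sc -!opA [c ** (t ** c)]opA ct ic.
Qed.

Lemma arrow_of_regular (eps : int -> S) s :
  (forall e, e ** e = e -> exists n, e = eps n) ->
  regular op -> exists i j t, arrow op eps i j s t.
Proof.
move=> epsP /(_ s)[t sts].
have [i ei] : exists i, s ** t = eps i by apply: epsP; rewrite opA -sts.
have [j ej] : exists j, t ** s = eps j.
  by apply: epsP; rewrite opA -(opA t s t) -(opA t) -sts.
exists i, j, (t ** s ** t); split.
- by rewrite !opA -sts ei.
- by rewrite -[_ ** s]opA -[_ ** (t ** s)]opA [s ** (t ** s)]opA -sts ej.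
- by rewrite -ei -sts.
- by rewrite -ej !opA -(opA t s t) -(opA t (s ** t)) -sts.
Qed.

(** For n < 0 any arrow from eps 0 to eps n will do; for n >= 0 the powers of a
single arrow are taken, which makes u trivial on the positive integers. *)
Lemma arrow_sequence (eps : int -> S) :
  (forall m n, eps m ** eps n = eps (Order.max m n)) ->
  injective eps -> (forall e, e ** e = e -> exists n, e = eps n) ->
  (forall i j, exists p q, arrow op eps i j p q) ->
  exists y y' : int -> S, [/\ forall n, arrow op eps 0 n (y n) (y' n),
    y 0 = eps 0 & forall n, 0 <= n -> y (n + 1) = y 1 ** y n].
Proof.
move=> epsM eps_inj epsP conn.
have /choice[z zP] : forall n, exists w : S * S, arrow op eps 0 n w.1 w.2.
  by move=> n; have [p [q pq]] := conn 0 n; exists (p, q).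
pose Y m := iter m (op (z 1).1) (eps 0).
pose Y' m := iter m (op^~ (z 1).2) (eps 0).
exists (fun n => if n is Posz m then Y m else (z n).1).
exists (fun n => if n is Posz m then Y' m else (z n).2).
split=> // [[m|m]|[m|//] _].
- elim: m => [|m IHm]; first exact: arrow_eps.
  have := arrow_comp opA eps_inj epsM epsP (zP 1) IHm ler01.
  by rewrite subr0 -PoszD addn1.
- exact: zP.
rewrite -PoszD addn1 /=; congr (_ ** _).
rewrite -[LHS](arrow_idr opA (zP 1)) -[in RHS](arrow_idr opA (zP 1)).
by rewrite -opA epsM.
Qed.

Lemma idempotent_chain : I_bisimple op -> exists eps : int -> S,
  [/\ injective eps, forall m n, eps m ** eps n = eps (Order.max m n) &
    forall e, e ** e = e -> exists n, e = eps n].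
Proof.
move=> [_ [eps [[eps_fun eps_inj eps_surj] eps_le]]]; exists eps; split.
- by move=> m n /eps_inj; apply; rewrite inE.
- by move=> m n; case: (leP m n) => [/eps_le[]|/ltW/eps_le[]].
- by move=> e /eps_surj[n _ <-]; exists n.
Qed.

Theorem warne_coordinates : regular op -> I_bisimple op ->
  exists (G : groupType) (theta : {multiplicative G -> G}) (u : int -> G)
    (phi : BW G -> S), [/\ forall n, 0 < n -> u n = 1%g, bijective phi &
    {morph phi : v w / BW_mul theta u v w >-> v ** w}].
Proof.
move=> reg bis; have [eps [eps_inj epsM epsP]] := idempotent_chain bis.
have conn i j := arrow_of_bisimple i j (eps_idem epsM) bis.1.
have [y [y' [yP y0 yS]]] := arrow_sequence epsM eps_inj epsP conn.
exists (maximal_subgroup opA (eps_idem epsM 0)).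
exists (theta_fun eps_inj epsP yP), (u_elt opA eps_inj epsM epsP yP).
exists (of_coords y y'); split.
- exact: u_elt_pos.
- rewrite -setTT_bijective; split=> // [v w _ _|s _].
    exact: of_coords_inj.
  have [i [j [t st]]] := arrow_of_regular s epsP reg.
  by have [w <-] := of_coords_surj opA eps_inj epsM epsP yP st; exists w.
- exact: of_coordsM.
Qed.

End Warne.

(** * Initial, transported and Hausdorff topologies *)
Section Transport.
Context {X Y : topologicalType}.

Lemma continuous_to_initial (Z : choiceType) (f : Z -> Y)
    (g : X -> initial_topology f) :
  continuous (f \o g : X -> Y) -> continuous g.
Proof.
move=> /continuousP cfg; apply/continuousP => _ [A oA <-].
exact: cfg.
Qed.

Lemma hausdorff_inj (f : X -> Y) :
  continuous f -> injective f -> hausdorff_space Y -> hausdorff_space X.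
Proof.
move=> cf inj_f hY p q pq; apply/inj_f/hY => A B /cf Ap /cf Bq.
by have [z [Az Bz]] := pq _ _ Ap Bq; exists (f z).
Qed.

End Transport.

Lemma hausdorff_equalizer (X Y : topologicalType) (f g : X -> Y) :
  hausdorff_space Y -> continuous f -> continuous g ->
  open [set x | f x <> g x].
Proof.
rewrite open_hausdorff => hY cf cg; rewrite openE => x /= /eqP fg.
have [[A B] /= [Af Bg] [oA oB AB]] := hY _ _ fg.
have : nbhs x (f @^-1` A `&` g @^-1` B).
  apply: filterI; [apply: cf|apply: cg]; apply: open_nbhs_nbhs; split=> //.
    exact: set_mem.
  exact: set_mem.
apply: filterS => z [/= Az Bz] fgz; rewrite -fgz in Bz.
by have : (A `&` B) (f z) by []; rewrite (eqP AB).
Qed.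

Section Pullback.
Context (X : topologicalType) (Y : choiceType) (psi : X -> Y).

Lemma final_openI : setI_closed [set U : set Y | open (psi @^-1` U)].
Proof. by move=> U V oU oV; exact: openI. Qed.

Lemma final_open_bigU (I : Type) (f : I -> set Y) :
  (forall i, open (psi @^-1` f i)) -> open (psi @^-1` \bigcup_i f i).
Proof. by move=> of_; rewrite preimage_bigcup; apply: bigcup_open => i _. Qed.

Definition final_topology : topology_on Y :=
  @TopologyOn Y [set U | open (psi @^-1` U)] openT final_openI final_open_bigU.

Context (phi : Y -> X) (phiK : cancel phi psi) (psiK : cancel psi phi).

Lemma final_continuous : continuous (psi : X -> with_topology final_topology).
Proof. exact/continuousP. Qed.

Lemma final_continuousV : continuous (phi : with_topology final_topology -> X).
Proof.
apply/continuousP => U oU.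
change (open (psi @^-1` (phi @^-1` U))).
suff -> : psi @^-1` (phi @^-1` U) = U by [].
by apply/seteqP; split=> x /=; rewrite psiK.
Qed.

Lemma final_semitopological (op : X -> X -> X) (opY : Y -> Y -> Y) :
  {morph phi : x y / opY x y >-> op x y} ->
  semitopological_semigroup op ->
  @semitopological_semigroup (with_topology final_topology) opY /\
  @topologically_isomorphic X (with_topology final_topology) op opY.
Proof.
move=> phiM [hX opA opC].
have opYE x y : opY x y = psi (op (phi x) (phi y)) by rewrite -phiM phiK.
split; last first.
  exists psi; split; last by move=> x y; rewrite opYE !psiK.
  split; first exact: final_continuous.
  by exists phi; split=> //; exact: final_continuousV.
split.
- exact: hausdorff_inj final_continuousV (can_inj phiK) hX.
- by move=> x y z; rewrite !opYE !psiK opA.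
- move=> x; split.
    have -> : opY x = psi \o op (phi x) \o phi.
      by apply/funext => y; exact: opYE.
    move=> y; apply: continuous_comp; first exact: final_continuousV.
    apply: continuous_comp; last exact: final_continuous.
    by have [+ _] := opC (phi x); exact.
  have -> : opY^~ x = psi \o (op^~ (phi x)) \o phi.
    by apply/funext => y; exact: opYE.
  move=> y; apply: continuous_comp; first exact: final_continuousV.
  apply: continuous_comp; last exact: final_continuous.
  by have [_ +] := opC (phi x); exact.
Qed.

End Pullback.

(** * Semitopological semigroups B_W *)
Section SemitopologicalBW.
Context {G : groupType} (t : topology_on (BW G)).
Context (theta : {multiplicative G -> G}) (u : int -> G).
Local Notation B := (with_topology t).
Local Notation mul := (BW_mul theta u : B -> B -> B).
Context (hB : @semitopological_semigroup B mul).

Lemma continuous_translate (v w : B) : continuous (fun x => mul (mul v x) w).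
Proof.
case: hB => _ _ cM x; apply: (@continuous_comp _ _ _ (mul v) (mul^~ w)).
  by have [+ _] := cM v; exact.
by have [_ +] := cM w; exact.
Qed.

(** A two-sided translation that replaces the outer coordinates of (i, g, j) and
keeps g: for matching coordinates the factors f and the powers of theta in the
multiplication are trivial. *)
Definition move_component (k i j l : int) (x : B) : B :=
  mul (mul (k, 1%g, i) x) (j, 1%g, l).

Lemma move_componentE k i j l g : move_component k i j l (i, g, j) = (k, g, l).
Proof. by rewrite /move_component !BW_mul_eq mul1g mulg1. Qed.

Lemma move_component_sub k i j l (x : set_type (BW_component t i j)) :
  BW_component t k l (move_component k i j l (val x)).
Proof.
have [g ->] := set_mem (valP x); exists g.
exact: move_componentE.
Qed.

Definition move_component_sig k i j l (x : set_type (BW_component t i j)) :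
  set_type (BW_component t k l) :=
  SigSub (mem_set (move_component_sub k l x)).

Lemma val_move_component_sig k i j l x :
  val (@move_component_sig k i j l x) = move_component k i j l (val x).
Proof. by []. Qed.

Lemma move_component_sigK k i j l :
  cancel (@move_component_sig k i j l) (@move_component_sig i k l j).
Proof.
move=> x; apply: val_inj; rewrite /=.
by have [g ->] := set_mem (valP x); rewrite !move_componentE.
Qed.

Lemma move_component_sig_continuous k i j l :
  continuous (@move_component_sig k i j l).
Proof.
apply: continuous_to_initial => x.
apply: (@continuous_comp _ _ _ set_val (move_component k i j l)).
  exact: initial_continuous.
exact: continuous_translate.
Qed.

Lemma move_component_homeo k i j l :
  homeomorphism (@move_component_sig k i j l).
Proof.
split; first exact: move_component_sig_continuous.
exists (@move_component_sig i k l j); split.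
- exact: move_component_sig_continuous.
- exact: move_component_sigK.
- exact: move_component_sigK.
Qed.

Lemma val_diagonal_mul i x y :
  val (BW_diagonal_mul t theta u i x y) = mul (val x) (val y).
Proof. by []. Qed.

Lemma component_coords i j (x : set_type (BW_component t i j)) :
  exists g, val x = (i, g, j).
Proof. exact: set_mem (valP x). Qed.

Definition component_elt i j (g : G) : set_type (BW_component t i j) :=
  SigSub (mem_set (ex_intro (fun h => (i, g, j) = (i, h, j)) g erefl)).

Lemma val_component_elt i j g : val (component_elt i j g) = (i, g, j).
Proof. by []. Qed.

Lemma diagonal_semitopological i :
  semitopological_group (BW_diagonal_mul t theta u i).
Proof.
have [hausB mulA cM] := hB.
split.
- apply: (@hausdorff_inj _ B set_val) hausB; last exact: val_inj.
  exact: initial_continuous.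
- split; first by move=> x y z; apply: val_inj; exact: mulA.
  exists (component_elt i i 1%g); split=> x; have [g xE] := component_coords x.
  + apply: val_inj.
    by rewrite val_diagonal_mul val_component_elt xE BW_mul_eq mul1g.
  + apply: val_inj.
    by rewrite val_diagonal_mul val_component_elt xE BW_mul_eq mulg1.
  + exists (component_elt i i g^-1%g).
    by split; apply: val_inj;
      rewrite val_diagonal_mul !val_component_elt xE BW_mul_eq ?mulgV ?mulVg.
- move=> x; split; apply: continuous_to_initial => y.
    apply: (@continuous_comp _ _ _ set_val (mul (val x))).
      exact: initial_continuous.
    by have [+ _] := cM (val x); exact.
  apply: (@continuous_comp _ _ _ set_val (mul^~ (val x))).
    exact: initial_continuous.
  by have [_ +] := cM (val x); exact.
Qed.

Lemma diagonal_isomorphic i k :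
  topologically_isomorphic (BW_diagonal_mul t theta u i)
                           (BW_diagonal_mul t theta u k).
Proof.
exists (@move_component_sig k i i k); split.
  exact: move_component_homeo.
move=> x y; apply: val_inj.
have [g xE] := component_coords x; have [h yE] := component_coords y.
rewrite [RHS]val_diagonal_mul !val_move_component_sig val_diagonal_mul xE yE.
by rewrite BW_mul_eq !move_componentE BW_mul_eq.
Qed.

Lemma embed_inj i : injective (BW_embed t i).
Proof. by move=> g h []. Qed.

Lemma embed_continuous i :
  continuous (BW_embed t i : BW_group_at t i -> B).
Proof. exact: initial_continuous. Qed.

Lemma group_at_continuous i (f : G -> G) (F : B -> B) :
  continuous F -> (forall g, BW_embed t i (f g) = F (BW_embed t i g)) ->
  continuous (f : BW_group_at t i -> BW_group_at t i).
Proof.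
move=> cF fF; apply: continuous_to_initial.
have -> : BW_embed t i \o f = F \o BW_embed t i by apply/funext => g; exact: fF.
by move=> g; apply: continuous_comp; [exact: embed_continuous|exact: cF].
Qed.

Lemma group_at_semitopological i :
  @semitopological_group (BW_group_at t i) (fun x y : G => (x * y)%g).
Proof.
have [hausB mulA cM] := hB; split.
- exact: hausdorff_inj (@embed_continuous i) (@embed_inj i) hausB.
- split; first exact: mulgA.
  exists 1%g; split; [exact: mul1g|exact: mulg1|].
  by move=> x; exists x^-1%g; rewrite mulgV mulVg.
- move=> x; have [cl cr] := cM (BW_embed t i x); split.
    by apply: group_at_continuous cl _ => g; rewrite /BW_embed BW_mul_eq.
  by apply: group_at_continuous cr _ => g; rewrite /BW_embed BW_mul_eq.
Qed.

Lemma theta_continuous i : (forall n : int, 0 < n -> u n = 1%g) ->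
  continuous (theta : BW_group_at t i -> BW_group_at t i).
Proof.
move=> u1.
(* Since f_{1,0} = u_1 = 1, theta g is the middle coordinate of
   (0, 1, 1) (0, g, 0) (1, 1, 0); F carries this formula out at level i. *)
pose F x := mul (mul (i, 1%g, 1) (move_component 0 i i 0 x)) (1, 1%g, i).
apply: (@group_at_continuous _ _ F) => [x|g].
  apply: (@continuous_comp _ _ _ (move_component 0 i i 0)
    (fun x => mul (mul (i, 1%g, 1) x) (1, 1%g, i))).
    exact: continuous_translate.
  exact: continuous_translate.
rewrite /F /BW_embed move_componentE.
have -> : mul (i, 1%g, 1) (0, g, 0) = (i, theta g, 1).
  rewrite /= subr0 /= !BW_f1 // invg1 !mul1g mulg1.
  by congr (_, _, _).
by rewrite BW_mul_eq mulg1.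
Qed.

(** The set {(a, g, b) | a <= i, b <= j} (see [lower_leftP]), described by
inequations that are visibly open. *)
Definition lower_left i j : set B :=
  [set x | mul (i + 1, 1%g, i + 1) x <> x /\ mul x (j + 1, 1%g, j + 1) <> x].

Lemma lower_left_open i j : open (lower_left i j).
Proof.
have [hausB mulA cM] := hB; apply: openI.
  apply: hausdorff_equalizer => //; last by move=> ?; exact: cvg_id.
  by have [] := cM (i + 1, 1%g, i + 1).
apply: hausdorff_equalizer => //; last by move=> ?; exact: cvg_id.
by have [] := cM (j + 1, 1%g, j + 1).
Qed.

Lemma lower_leftP i j a (g : G) b :
  lower_left i j (a, g, b) <-> a <= i /\ b <= j.
Proof.
rewrite /lower_left /= -/mul.
split=> [[+ +]|[ai bj]]; last first.
  by split=> [/BW_mull_eq|/BW_mulr_eq]; lia.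
move=> ai bj; split; rewrite leNgt; apply/negP => lt.
  by apply: ai; apply/BW_mull_eq; lia.
by apply: bj; apply/BW_mulr_eq; lia.
Qed.

(** Only the outer coordinates matter.  Multiplying by (i, 1, i) and (j, 1, j)
moves (a, h, b) up its diagonal until the coordinates are at least i and j; one
of them is then strictly larger, unless (a, b) and (i, j) lie on the same
diagonal. *)
Lemma component_nbhs i (g : G) j : exists U : set B,
  [/\ open U, U (i, g, j) &
      U `<=` \bigcup_k BW_component t (i - k%:Z) (j - k%:Z)].
Proof.
pose F x := mul (mul (i, 1%g, i) x) (j, 1%g, j).
exists (lower_left i j `&` F @^-1` lower_left i j); split.
- apply: openI; first exact: lower_left_open.
  apply: open_comp; last exact: lower_left_open.
  by move=> x _; exact: continuous_translate.
- have ijP : lower_left i j (i, g, j) by apply/lower_leftP.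
  by split=> //=; rewrite /F !BW_mul_eq mul1g mulg1.
case=> [[a h] b] [/lower_leftP[ai bj]]; rewrite /= /F.
have [h' ->] : exists h', mul (i, 1%g, i) (a, h, b) = (i, h', b - a + i).
  by rewrite /= ai; eexists.
have [jb|bj'] := lerP j (b - a + i).
  have [h'' ->] : exists h'', mul (i, h', b - a + i) (j, 1%g, j)
      = (i, h'', b - a + i).
    rewrite /= jb; eexists; congr (_, _, _); lia.
  move=> /lower_leftP[_ le_j]; exists `|i - a|%N => //.
  by exists h; congr (_, _, _); lia.
have [h'' ->] : exists h'', mul (i, h', b - a + i) (j, 1%g, j)
    = (i - (b - a + i) + j, h'', j).
  rewrite /= leNgt bj' /=; eexists; reflexivity.
move=> /lower_leftP[le_i _]; exists `|i - a|%N => //.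
by exists h; congr (_, _, _); lia.
Qed.

End SemitopologicalBW.

(** * Discreteness of the idempotents *)
Section IdempotentsDiscrete.
Context (S : topologicalType) (op : S -> S -> S).
Local Notation "x ** y" := (op x y) (at level 40, left associativity).

Lemma idempotents_discrete : semitopological_semigroup op -> I_bisimple op ->
  discrete_subspace (idempotents op).
Proof.
move=> [hS opA cM] /idempotent_chain[eps [eps_inj epsM epsP]] U.
rewrite openE => -[e eE] Ue; have [n ne] := epsP _ (set_mem eE).
(* On idempotents, the first condition excludes the indices above n, and the
   second those below n: eps (n - 1) x = eps (n - 1) if the index of x is at
   most n - 1. *)
pose V : set S := [set x | eps (n + 1) ** x <> x] `&`
  [set x | eps (n - 1) ** x <> eps (n - 1)].
have oV : open V.
  apply: openI.
    apply: hausdorff_equalizer => //; last by move=> ?; exact: cvg_id.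
    by have [] := cM (eps (n + 1)).
  apply: hausdorff_equalizer => //; last by move=> ?; exact: cvg_cst.
  by have [] := cM (eps (n - 1)).
have VP m : V (eps m) <-> m = n.
  rewrite /V /= !epsM; split=> [[up down]|->]; last first.
    by split=> /eps_inj; rewrite maxEle; case: ifP; lia.
  apply/eqP; rewrite eq_le !leNgt; apply/andP; split; apply/negP => mn.
    by apply: up; rewrite max_r //; lia.
  by apply: down; rewrite max_l //; lia.
exists (set_val @^-1` V).
  split; first by exists V.
  by have := (VP n).2 erefl; rewrite -ne.
move=> x /= Vx; have [m xm] := epsP _ (set_mem (valP x)).
suff -> : x = exist _ e eE by [].
by apply: val_inj; rewrite /= ne -(VP m).1 -xm.
Qed.

End IdempotentsDiscrete.

(** * The structure theorem *)

Theorem theorem3p2 (S : topologicalType) (op : S -> S -> S)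
  (hS : semitopological_semigroup op) (hreg : regular op)
  (hbis : I_bisimple op) :
  exists (G : groupType) (theta : {multiplicative G -> G}) (u : int -> G)
    (t : topology_on (BW G)),
    (forall n : int, 0 < n -> u n = 1%g) /\
    [/\ (* i *)
        @semitopological_semigroup (with_topology t) (BW_mul theta u)
        /\ @topologically_isomorphic S (with_topology t) op (BW_mul theta u),
        (* ii *)
        forall i j k l : int,
          homeomorphic (set_type (BW_component t i j))
                       (set_type (BW_component t k l)),
        (* iii *)
        forall i k : int,
          [/\ semitopological_group (BW_diagonal_mul t theta u i),
              semitopological_group (BW_diagonal_mul t theta u k) &
              topologically_isomorphic (BW_diagonal_mul t theta u i)
                                       (BW_diagonal_mul t theta u k)],
        (* iv *)
        forall i : int,
          @semitopological_group (BW_group_at t i) (fun x y : G => (x * y)%g)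
          /\ continuous (theta : BW_group_at t i -> BW_group_at t i) &
        (* v *)
        forall (i : int) (g : G) (j : int),
          exists U : set (with_topology t),
            [/\ open U, U (i, g, j) &
                U `<=` \bigcup_k BW_component t (i - k%:Z) (j - k%:Z)]]
    /\ (* vi *) discrete_subspace (idempotents op).
Proof.
have [_ opA _] := hS.
have [G [theta [u [phi [u1 [psi phiK psiK] phiM]]]]] :=
  warne_coordinates opA hreg hbis.
have [hB isoB] := final_semitopological phiK psiK phiM hS.
exists G, theta, u, (final_topology psi); split=> //; split; last first.
  exact: idempotents_discrete.
split=> //.
- move=> i j k l; exists (@move_component_sig _ _ theta u k i j l).
  exact: move_component_homeo.
- move=> i k; split; [exact: diagonal_semitopological..|].
  exact: diagonal_isomorphic.
- move=> i; split; first exact: group_at_semitopological hB i.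
  exact: theta_continuous hB i u1.
- exact: component_nbhs hB.
Qed.
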